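(* Degree sequence does not characterize geodesic Leech graphs; that is, there exist two graphs $G$ and $H$ with the same degree sequence such that $G$ is a geodesic Leech graph and $H$ is not a geodesic Leech graph.
   Context: All graphs are finite, simple and undirected. A geodesic path in a graph $G$ is a path with at least one edge which is a shortest path in $G$ between its two end vertices; paths are undirected (a path and its reversal are the same path). The geodesic path number $t_{gp}(G)$ is the total number of geodesic paths in $G$. For an edge labeling $f : E(G) \to \{1,2,3,\dots\}$, the weight of a path $P$ is $w(P) = \sum_{e \in E(P)} f(e)$. The labeling $f$ is a geodesic Leech labeling of $G$ if the set of weights of the $t_{gp}(G)$ geodesic paths in $G$ is $\{1,2,\dots,t_{gp}(G)\}$ (so each of these values is the weight of exactly one geodesic path). A graph which admits a geodesic Leech labeling is called a geodesic Leech graph. *)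

(* Defs.v *)
From mathcomp Require Import all_boot.

Set Implicit Arguments.
Unset Strict Implicit.
Unset Printing Implicit Defensive.

Record sgraph := SGraph {
  vertex :> finType;
  adj : rel vertex;
  adj_sym : symmetric adj;
  adj_irr : irreflexive adj }.

Definition degree (G : sgraph) (x : G) : nat := #|[set y | adj x y]|.

Definition degree_sequence (G : sgraph) : seq nat :=
  sort geq [seq degree x | x : G].

Definition edges (G : sgraph) : {set {set G}} :=
  [set [set x; y] | x : G, y : G in adj x].

(* As in path.v, a path is given by its first vertex x and the sequence p of
   the following ones; its length is size p. *)
Definition is_path (G : sgraph) (x : G) (p : seq G) : bool :=
  path (@adj G) x p && uniq (x :: p).

Definition path_edges (G : sgraph) (x : G) (p : seq G) : {set {set G}} :=
  [set e in pairmap (fun u v => [set u; v]) x p].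

(* Since the vertices of a path are distinct, bounding the size of q by #|G|
   excludes no path; see geodesicP. *)
Definition geodesic (G : sgraph) (x : G) (p : seq G) : bool :=
  [&& 0 < size p, is_path x p
    & [forall q : #|G|.-bseq G,
        (is_path x q && (last x q == last x p)) ==> (size p <= size q)]].

(* An undirected path with at least one edge is determined by its set of edges,
   so identifying a path with its edge set identifies it with its reversal and
   with no other path. *)
Definition geodesic_paths (G : sgraph) : {set {set {set G}}} :=
  [set path_edges x p | x : G,
     p : #|G|.-bseq G in [pred q : #|G|.-bseq G | geodesic x q]].

Definition t_gp (G : sgraph) : nat := #|geodesic_paths G|.

(* Labels are only meaningful on edges G; the values of f at other sets are
   never used. *)
Definition edge_labeling (G : sgraph) (f : {set G} -> nat) : Prop :=
  forall e, e \in edges G -> 0 < f e.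

Definition weight (G : sgraph) (f : {set G} -> nat) (P : {set {set G}}) : nat :=
  \sum_(e in P) f e.

Definition geodesic_leech_labeling (G : sgraph) (f : {set G} -> nat) : Prop :=
  edge_labeling f /\
  [seq weight f P | P in geodesic_paths G] =i iota 1 (t_gp G).

Definition geodesic_leech_graph (G : sgraph) : Prop :=
  exists f : {set G} -> nat, geodesic_leech_labeling f.

Lemma is_path_size (G : sgraph) (x : G) (p : seq G) :
  is_path x p -> size p <= #|G|.
Proof.
case/andP=> _ Up; apply: ltnW.
by rewrite -[(size p).+1]/(size (x :: p)) -(card_uniqP Up) max_card.
Qed.

Lemma geodesicP (G : sgraph) (x : G) (p : seq G) :
  reflect [/\ 0 < size p, is_path x p &
             forall q, is_path x q -> last x q = last x p -> size p <= size q]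
          (geodesic x p).
Proof.
apply: (iffP and3P) => -[p_gt0 Pp min_p]; split=> //.
  move=> q Pq /eqP eq_last.
  have := forallP min_p (Bseq (is_path_size Pq)).
  by rewrite /= Pq eq_last.
by apply/forallP=> q; apply/implyP=> /andP[Pq /eqP eq_last]; apply: min_p.
Qed.

Lemma geodesic_pathsP (G : sgraph) (P : {set {set G}}) :
  reflect (exists x p, geodesic x p /\ P = path_edges x p)
          (P \in geodesic_paths G).
Proof.
apply: (iffP imset2P) => [[x p _ gp ->]|[x [p [gp ->]]]]; first by exists x, p.
have /and3P[_ Pp _] := gp.
by exists x (Bseq (is_path_size Pp)).
Qed.

(* Main.v *)
(* A disjoint union of complete graphs is geodesic Leech, since its geodesic
   paths are its edges, which can be labeled 1, 2, 3, ... in any order.  So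
   K2 + K3 is geodesic Leech.  It has the degree sequence 2, 2, 2, 1, 1 of the
   path P5, whose 10 subpaths are all geodesic; but no four positive integers
   have their sums over blocks of consecutive terms equal to 1, ..., 10 in some
   order. *)
Require Import Defs.
From mathcomp Require Import all_boot.
From mathcomp Require Import zify.

Set Implicit Arguments.
Unset Strict Implicit.
Unset Printing Implicit Defensive.

(** * Disjoint unions of complete graphs *)

Section ClusterGraph.

Variables (T : finType) (K : eqType) (g : T -> K).

(** The disjoint union of the complete graphs on the fibres of [g]. *)
Definition cluster_adj : rel T := fun x y => (x != y) && (g x == g y).

Lemma cluster_adj_sym : symmetric cluster_adj.
Proof. by move=> x y; rewrite /cluster_adj eq_sym [g x == _]eq_sym. Qed.

Lemma cluster_adj_irr : irreflexive cluster_adj.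
Proof. by move=> x; rewrite /cluster_adj eqxx. Qed.

Definition cluster_graph : sgraph := SGraph cluster_adj_sym cluster_adj_irr.

Lemma cluster_path_last (x : T) (p : seq T) :
  path cluster_adj x p -> g (last x p) = g x.
Proof. by elim: p x => //= y p IHp x /andP[/andP[_ /eqP ->] /IHp]. Qed.

(** A path stays in one fibre of [g], so its two distinct ends are adjacent and the single edge
    between them is a competing path; a geodesic thus has length one. *)
Lemma cluster_geodesic_paths :
  geodesic_paths cluster_graph = [set [set e] | e in edges cluster_graph].
Proof.
apply/setP=> P; apply/geodesic_pathsP/imsetP => [[x [p [/geodesicP[]]]]|[e]].
  case: p => // y p _ /andP[pp /andP[x_notin _]] min_p ->.
  have xl : x != last x (y :: p).
    by apply: contraNneq x_notin => {1}->; rewrite /= mem_last.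
  have xlP : @is_path cluster_graph x [:: last x (y :: p)].
    by rewrite /is_path /= /cluster_adj mem_seq1 xl -(cluster_path_last pp) eqxx.
  have le1 := min_p _ xlP erefl.
  case: p pp le1 {min_p xlP xl x_notin} => // pp _.
  exists [set x; y]; last by apply/setP=> e; rewrite !inE.
  by apply/imset2P; exists x y => //; case/andP: pp.
case/imset2P=> x y _ xy -> ->; exists x, [:: y]; split; last first.
  by apply/setP=> e'; rewrite !inE.
have {}xy : cluster_adj x y by [].
have xNy : x != y by case/andP: xy.
apply/geodesicP; split=> //; first by rewrite /is_path /= mem_seq1 xy xNy.
by case=> // _ /= eq_xy; rewrite eq_xy eqxx in xNy.
Qed.

Lemma cluster_geodesic_leech : geodesic_leech_graph cluster_graph.
Proof.
pose E := edges cluster_graph.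
(* [index] counts from 0, so the successor makes the labels run from 1 to the number of edges. *)
exists (fun e => (index e (enum E)).+1); split=> // w.
rewrite /t_gp cluster_geodesic_paths (card_imset _ set1_inj) mem_iota add1n.
apply/imageP/andP => [[_ /imsetP[e eE ->] ->]|[w_gt0 w_le]].
  by rewrite /weight big_set1; split; rewrite // ltnS cardE index_mem mem_enum.
have w_lt : w.-1 < size (enum E) by rewrite -cardE -ltnS prednK.
have eE : nth set0 (enum E) w.-1 \in E by rewrite -mem_enum mem_nth.
exists [set nth set0 (enum E) w.-1]; first exact: imset_f.
by rewrite /weight big_set1 index_uniq ?enum_uniq // prednK.
Qed.

End ClusterGraph.

(** * Geodesics of a path graph *)

Section PathGraph.

Variable n : nat.

Definition path_adj : rel 'I_n.+1 :=
  fun i j => (j == i.+1 :> nat) || (i == j.+1 :> nat).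

Lemma path_adj_sym : symmetric path_adj.
Proof. by move=> i j; rewrite /path_adj orbC. Qed.

Lemma path_adj_irr : irreflexive path_adj.
Proof. by move=> i; rewrite /path_adj; lia. Qed.

Definition path_graph : sgraph := SGraph path_adj_sym path_adj_irr.

(** Indexing by [nat] turns weights into sums over integer intervals. Only [k < n] gives an edge,
    since [inord] sends values out of range to 0. *)
Definition path_edge (k : nat) : {set 'I_n.+1} := [set inord k; inord k.+1].

(** The edge set of the path between the vertices [i] and [j]; its last edge is [path_edge j.-1],
    hence the half-open range. *)
Definition subpath (i j : nat) : {set {set 'I_n.+1}} :=
  [set e in [seq path_edge k | k <- index_iota i j]].

Lemma path_edge_inj : {in gtn n &, injective path_edge}.
Proof.
move=> k l; rewrite !inE => ltkn ltln /setP eq_kl.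
have := eq_kl (inord k); have := eq_kl (inord k.+1).
by rewrite !inE -!val_eqE /= !inordK; lia.
Qed.

Lemma mem_subpath (i j k : nat) :
  j <= n -> k < n -> (path_edge k \in subpath i j) = (i <= k < j).
Proof.
move=> le_jn lt_kn; rewrite inE; apply/mapP/idP => [[l]|lt_ikj].
  by rewrite mem_index_iota => lt_ilj /path_edge_inj -> //; rewrite inE; lia.
by exists k; rewrite ?mem_index_iota.
Qed.

Lemma subpath_inj (i j i' j' : nat) :
  i < j <= n -> i' < j' <= n -> subpath i j = subpath i' j' ->
  (i, j) = (i', j').
Proof.
move=> lt_ij lt_ij' /setP eq_ij.
have mem k : k < n -> (i <= k < j) = (i' <= k < j').
  by move=> lt_kn; rewrite -!mem_subpath //; lia.
(* The extreme edge indices of both intervals suffice to recover their ends. *)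
have := mem i; have := mem i'; have := mem j.-1; have := mem j'.-1.
by move=> *; congr pair; lia.
Qed.

Lemma weight_subpath (f : {set 'I_n.+1} -> nat) (i j : nat) :
  j <= n ->
  @weight path_graph f (subpath i j) = \sum_(i <= k < j) f (path_edge k).
Proof.
move=> le_jn; rewrite /weight /subpath.
under eq_bigl do rewrite inE.
rewrite -big_uniq ?big_map //= map_inj_in_uniq ?iota_uniq // => k l.
by rewrite !mem_index_iota => ? ?; apply: path_edge_inj; rewrite inE; lia.
Qed.

Lemma subpath_recl (i j : nat) :
  i < j -> subpath i j = path_edge i |: subpath i.+1 j.
Proof.
by move=> lt_ij; apply/setP=> e; rewrite !inE /index_iota -(subnSK lt_ij).
Qed.

Lemma subpath_recr (i j : nat) :
  i <= j -> subpath i j.+1 = path_edge j |: subpath i j.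
Proof.
move=> le_ij; apply/setP=> e.
by rewrite !inE /index_iota subSn // -[(j - i).+1]addn1 iotaD map_cat mem_cat /= !inE
  subnKC // orbC.
Qed.

(* A path never turns back, so it is a monotone run of vertices. *)
Lemma path_graph_path (x : 'I_n.+1) (p : seq 'I_n.+1) :
  @is_path path_graph x p ->
    (all (fun y : 'I_n.+1 => x < y) p /\
       @path_edges path_graph x p = subpath x (last x p))
  \/ (all (fun y : 'I_n.+1 => y < x) p /\
       @path_edges path_graph x p = subpath (last x p) x).
Proof.
have edges0 z : @path_edges path_graph z [::] = subpath z z.
  by apply/setP=> e; rewrite !inE /index_iota subnn.
have edgesS z y q : @path_edges path_graph z (y :: q)
    = [set z; y] |: @path_edges path_graph y q.
  by apply/setP=> e; rewrite !inE.
elim: p x => [|y p IHp] x; first by left; split; rewrite //= edges0.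
rewrite /is_path => /andP[/= /andP[xy pp] /and3P[xp yp Up]].
have edge_up (i j : 'I_n.+1) : j = i.+1 :> nat -> path_edge i = [set i; j].
  by move=> ij; rewrite /path_edge -ij !inord_val.
have Pp : @is_path path_graph y p by rewrite /is_path pp /= yp.
have x_notin : x \notin p by move: xp; rewrite inE negb_or => /andP[].
have le_last (z : 'I_n.+1) (P : rel nat) :
    reflexive P -> all (fun u : 'I_n.+1 => P z u) p -> P z (last z p).
  move=> Pr /allP Pz; have := mem_last z p; rewrite inE.
  by case/predU1P=> [->|/Pz].
rewrite edgesS; case/orP: xy => /eqP xy; [left | right].
  (* If the rest of the path descended from [y], its next vertex would be [y - 1 = x], which cannot
     be repeated. For empty [p] both cases give the empty edge set. *)
  have [gt_p ->]: all (fun u : 'I_n.+1 => y < u) p /\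
      @path_edges path_graph y p = subpath y (last y p).
    case: (IHp _ Pp) => // -[]; case: p pp x_notin {IHp xp yp Up Pp le_last}.
      by rewrite edges0.
    move=> z p /= /andP[yz _]; rewrite inE negb_or -val_eqE /= => /andP[xz _].
    by move: yz; rewrite /path_adj; lia.
  split=> /=.
    rewrite xy leqnn; apply: sub_all gt_p => u /=; lia.
  have le_yl : y <= last y p.
    by apply: le_last leqnn _; apply: sub_all gt_p => u; apply: ltnW.
  by rewrite [RHS]subpath_recl -?xy // (edge_up _ _ xy).
have [lt_p ->]: all (fun u : 'I_n.+1 => u < y) p /\
    @path_edges path_graph y p = subpath (last y p) y.
  case: (IHp _ Pp) => // -[]; case: p pp x_notin {IHp xp yp Up Pp le_last}.
    by rewrite edges0.
  move=> z p /= /andP[yz _]; rewrite inE negb_or -val_eqE /= => /andP[xz _].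
  by move: yz; rewrite /path_adj; lia.
split=> /=.
  rewrite xy leqnn; apply: sub_all lt_p => u /=; lia.
have le_ly : last y p <= y.
  by apply: (le_last y geq leqnn); apply: sub_all lt_p => u; apply: ltnW.
by rewrite [in RHS]xy subpath_recr // (edge_up _ _ xy) [[set x; y]]setUC.
Qed.

(** Each step raises the index by at most one. This lower bound on length shows that increasing runs
    are shortest. *)
Lemma path_graph_dist (x : 'I_n.+1) (p : seq 'I_n.+1) :
  path path_adj x p -> last x p - x <= size p.
Proof.
elim: p x => [|y p IHp] x /=; first by rewrite subnn.
by case/andP=> xy /IHp; move: xy; rewrite /path_adj; lia.
Qed.

Lemma inord_iota_path (i m : nat) :
  i + m <= n ->
  @is_path path_graph (inord i) [seq inord k | k <- iota i.+1 m].
Proof.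
move=> le_imn; apply/andP; split; last first.
  rewrite -[_ :: _]/[seq inord k | k <- iota i m.+1].
  rewrite map_inj_in_uniq ?iota_uniq // => k l; rewrite !mem_iota => ik il.
  by move/(congr1 val); rewrite /= !inordK; lia.
elim: m i le_imn => //= m IHm i le_imn; rewrite IHm ?andbT; last by lia.
by rewrite /path_adj !inordK; lia.
Qed.

Lemma path_graph_geodesic_paths (P : {set {set 'I_n.+1}}) :
  reflect (exists i j, i < j <= n /\ P = subpath i j)
          (P \in geodesic_paths path_graph).
Proof.
apply: (iffP (@geodesic_pathsP path_graph P)) => [[x [p [gp ->]]]|].
  have [p_gt0 Pp _] := geodesicP _ _ gp.
  have lp : last x p \in p.
    by case: p p_gt0 {gp Pp} => // y p _; rewrite /= mem_last.
  case: (path_graph_path Pp) => -[/allP/(_ _ lp) lt_xl ->].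
    by exists x, (last x p); rewrite lt_xl -ltnS ltn_ord.
  by exists (last x p), x; rewrite lt_xl -ltnS ltn_ord.
case=> i [j [/andP[lt_ij le_jn] ->]].
pose p : seq 'I_n.+1 := [seq inord k | k <- iota i.+1 (j - i)].
have Pp : @is_path path_graph (inord i) p by apply: inord_iota_path; lia.
have vi : (inord i : 'I_n.+1) = i :> nat by rewrite inordK; lia.
have lp : last (inord i) p = inord j.
  rewrite /p last_map -nth_last size_iota.
  by rewrite nth_iota ?subn_gt0; [congr inord|]; lia.
have vj : (inord j : 'I_n.+1) = j :> nat by rewrite inordK; lia.
exists (inord i), p; split.
  apply/geodesicP; split=> //; first by rewrite size_map size_iota subn_gt0.
  move=> q /andP[/path_graph_dist le_q _] lq; move: le_q.
  by rewrite lq lp vi vj size_map size_iota.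
have lpp : last (inord i) p \in p.
  by rewrite lp; apply: map_f; rewrite mem_iota; lia.
(* The decreasing alternative is impossible because [i < j]. *)
by case: (path_graph_path Pp) => -[/allP/(_ _ lpp)]; rewrite lp vi vj //; lia.
Qed.

End PathGraph.

(** * The path on five vertices and the sums of its labels *)

Lemma P5_block_sums (a b c d : nat) :
  0 < a -> 0 < b -> 0 < c -> 0 < d -> a + b + c + d <= 10 ->
  ~~ perm_eq [:: a; b; c; d; a + b; b + c; c + d; a + b + c; b + c + d;
                 a + b + c + d] (iota 1 10).
Proof.
move=> a0 b0 c0 d0 le10.
(* Each number is at most 10 minus the other three, hence at most 7, so finitely many quadruples
   remain to be computed. *)
have /allP ok : all (fun a => all (fun b => all (fun c => all (fun d =>
    ~~ perm_eq [:: a; b; c; d; a + b; b + c; c + d; a + b + c; b + c + d;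
                   a + b + c + d] (iota 1 10))
    (iota 1 7)) (iota 1 7)) (iota 1 7)) (iota 1 7) by vm_compute.
have mem7 k : 0 < k -> k <= 7 -> k \in iota 1 7 by rewrite mem_iota; lia.
have /ok/allP/(_ b)oka : a \in iota 1 7 by apply: mem7; lia.
have /oka/allP/(_ c)okb : b \in iota 1 7 by apply: mem7; lia.
have /okb/allP/(_ d)okc : c \in iota 1 7 by apply: mem7; lia.
by apply: okc; apply: mem7; lia.
Qed.

Lemma P5_not_geodesic_leech : ~ geodesic_leech_graph (path_graph 4).
Proof.
case=> f [f_gt0 fW].
(* The ends of the ten subpaths, sorted by length to match the order of the sums in
   [P5_block_sums]. *)
pose s := [:: (0, 1); (1, 2); (2, 3); (3, 4); (0, 2); (1, 3); (2, 4); (0, 3);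
              (1, 4); (0, 4)].
have s_mem i j : ((i, j) \in s) = (i < j <= 4) by rewrite !inE !xpair_eqE; lia.
pose S := [seq subpath 4 u.1 u.2 | u <- s].
have US : uniq S.
  rewrite map_inj_in_uniq // => -[i j] [i' j']; rewrite !s_mem.
  exact: subpath_inj.
have gpE : geodesic_paths (path_graph 4) = [set P in S].
  apply/setP=> P; rewrite inE.
  apply/path_graph_geodesic_paths/mapP => [[i [j [ij ->]]]|[[i j] ij ->]].
    by exists (i, j); rewrite ?s_mem.
  by exists i, j; rewrite -s_mem.
have t10 : t_gp (path_graph 4) = 10 by rewrite /t_gp gpE cardsE (card_uniqP US).
pose a k := f (path_edge 4 k).
have weights : [seq @weight (path_graph 4) f P | P <- S] =
   [:: a 0; a 1; a 2; a 3; a 0 + a 1; a 1 + a 2; a 2 + a 3; a 0 + a 1 + a 2;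
       a 1 + a 2 + a 3; a 0 + a 1 + a 2 + a 3].
  by rewrite /S /= !weight_subpath // unlock /= !addn0 !addnA.
have W10 : [seq @weight (path_graph 4) f P | P <- S] =i iota 1 10.
  move=> w; rewrite -t10 -fW; apply/mapP/imageP=> -[P PS ->]; exists P => //.
    by rewrite gpE inE.
  by rewrite gpE inE in PS.
have perm10 : perm_eq [seq @weight (path_graph 4) f P | P <- S] (iota 1 10).
  apply: uniq_perm; rewrite ?iota_uniq //.
  (* Ten weights that cover ten distinct values cannot repeat. *)
  by rewrite (@uniq_size_uniq _ (iota 1 10)) ?iota_uniq // => w; rewrite W10.
have bounds w : w \in [seq @weight (path_graph 4) f P | P <- S] -> 0 < w <= 10.
  by rewrite W10 mem_iota; lia.
rewrite weights in perm10 bounds; move: perm10; apply/negP.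
by apply: P5_block_sums; [have := bounds (a 0) | have := bounds (a 1)
  | have := bounds (a 2) | have := bounds (a 3)
  | have := bounds (a 0 + a 1 + a 2 + a 3)]; rewrite !inE eqxx ?orbT;
  case/(_ isT)/andP.
Qed.

Theorem theorem2p9 :
  exists G H : sgraph,
    [/\ degree_sequence G = degree_sequence H,
        geodesic_leech_graph G
      & ~ geodesic_leech_graph H].
Proof.
(* The fibres are {1, 2, 3} and {0, 4}, giving K3 + K2. With this numbering each vertex has the same
   degree as in the path, so the degree lists agree even before sorting. *)
exists (cluster_graph (fun i : 'I_5 => 0 < i < 4)), (path_graph 4); split.
- congr sort; apply: eq_map => /= x; rewrite /degree -!sum1dep_card.
  rewrite [LHS]big_mkcond [RHS]big_mkcond /= !big_ord_recr !big_ord0 /=.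
  by rewrite /cluster_adj /path_adj -!val_eqE /=; case: x => -[|[|[|[|[|]]]]].
- exact: cluster_geodesic_leech.
- exact: P5_not_geodesic_leech.
Qed.
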